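(* Let $\overline{\Omega}\subset\mathbb{R}^D\setminus\{S_1,\dots,S_n\}$ consist of the open set $\Omega$ and its boundary $\partial\Omega$. If $J(X)$ is non-constant on $\Omega$, then: 1. If $D\le 4$, then $J(X)$ obtains its maximum in $\overline{\Omega}$ only on $\partial\Omega$. 2. If $D\ge 4$, then $J(X)$ obtains its minimum in $\overline{\Omega}$ only on $\partial\Omega$.
   Context: Let $D\in\{1,2,3,\dots\}$ be the dimension of the Euclidean space $\mathbb{R}^D$. Let $S_i=(s_{1i},s_{2i},\dots,s_{Di})\in\mathbb{R}^D$, $i=1,2,\dots,n$, be $n$ point sources, and let $w_i>0$ be the strength of the quantity emitted by source $i$. The region $\overline{\Omega}$ is affected by the point sources and contains none of them, i.e. $\overline{\Omega}\cap\{S_1,\dots,S_n\}=\varnothing$; it need not be connected. The combined effect of the point sources at $X=(x_1,x_2,\dots,x_D)$ is $$J(X)=\sum_{i=1}^n\frac{w_i}{\sum_{k=1}^D (x_k-s_{ki})^2}.$$ *)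

(* Defs.v *)
From HB Require Import structures.
From mathcomp Require Import all_boot all_order all_algebra.
From mathcomp Require Import all_classical all_reals all_analysis.

Set Implicit Arguments.
Unset Strict Implicit.
Unset Printing Implicit Defensive.

Import Order.TTheory GRing.Theory Num.Theory.
Import numFieldNormedType.Exports.

Local Open Scope classical_set_scope.
Local Open Scope ring_scope.

(* R^D is 'rV[R]_D; the library topologizes it by the max norm, which gives the
   Euclidean topology. The squared Euclidean distance in J is written out
   because `|X - S i| would denote the max norm. *)
Definition J (R : realType) (D n : nat) (S : 'I_n -> 'rV[R]_D)
    (w : 'I_n -> R) (X : 'rV[R]_D) : R :=
  \sum_(i < n) w i / \sum_(k < D) (X ord0 k - S i ord0 k) ^+ 2.

Definition boundary (T : topologicalType) (A : set T) : set T :=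
  closure A `\` A°.

Definition nonconstant_on (T U : Type) (f : T -> U) (A : set T) : Prop :=
  exists x y, [/\ A x, A y & f x <> f y].

Definition max_on_at (R : realType) (T : Type) (f : T -> R) (A : set T)
    (x : T) : Prop :=
  A x /\ forall y, A y -> f y <= f x.

Definition min_on_at (R : realType) (T : Type) (f : T -> R) (A : set T)
    (x : T) : Prop :=
  A x /\ forall y, A y -> f x <= f y.

(* Main.v *)
Require Import Defs.
From HB Require Import structures.
From mathcomp Require Import all_boot all_order all_algebra.
From mathcomp Require Import all_classical all_reals all_analysis.
From mathcomp Require Import ring lra.

Import Order.TTheory GRing.Theory Num.Theory.
Import numFieldNormedType.Exports.

Local Open Scope classical_set_scope.
Local Open Scope ring_scope.

(** The Laplacian of |x - c|^(-2m) is 2m (2m + 2 - D) |x - c|^(-2m-2). For m = 1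
    its sign is that of 4 - D, so J is subharmonic when D <= 4 and -J is
    subharmonic when D >= 4, and both claims are the strong maximum principle
    for s J with s = 1 or s = -1.

    That principle is obtained without integration
    ([strong_maximum_ball]). Suppose F is subharmonic on a closed ball centred
    at z, attains its maximum over the ball at an inner point x, and
    F z < F x. Then F stays below F x by a fixed margin near z. Adding a small
    multiple of the barrier |y - z|^(-2D), which is strictly subharmonic
    (the formula above with m = D) and decreases with the distance to z, gives
    a function whose maximum over an annulus around z lies neither on the inner
    sphere, where the margin prevails, nor on the outer one, where the barrier
    is smaller than at x. At an inner maximum the Laplacian is nonpositive,
    a contradiction. Hence F z = F x for every z close to x: a function that has
    an interior maximum is constant near it.

    As Omega may be disconnected, local constancy near x does not contradict
    non-constancy on Omega. It does contradict the shape of J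
    ([J_not_locally_constant]): along the line from x to a source, J is
    a rational function of the parameter, so being constant near 0 it is
    constant wherever it is defined, although it blows up at the source.

    Second derivatives enter only through Peano expansions of order two along
    the coordinate directions. These exist for the functions at hand by algebra,
    and they suffice for the second-order necessary condition at a maximum. *)

(** * Second-order expansions of functions of one variable *)

(** [a] and [b] are the first derivative and half the second derivative of [f] at
    0. Asking for a remainder factor that is continuous at 0, instead of
    a limit of a quotient, reduces the product rule to an identity. *)
Definition jet2 {R : realType} (f : R -> R) (a b : R) : Prop :=
  exists g : R -> R, [/\ {for 0, continuous g}, g 0 = b &
    \forall t \near 0, f t = f 0 + a * t + t ^+ 2 * g t].

Lemma jet2_le0 {R : realType} {f : R -> R} {a b : R} :
  jet2 f a b -> (\forall t \near 0, f t <= f 0) -> b <= 0.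
Proof.
move=> [g [cg <- fg]] fmax; rewrite leNgt; apply/negP => g0.
have gpos : \forall t \near 0, 0 < g t by exact: (cvgr_gt _ cg).
have /nbhs_ballP[e /= e0 He] : \forall t \near 0,
    [/\ f t = f 0 + a * t + t ^+ 2 * g t, f t <= f 0 & 0 < g t].
  by near=> t; split; near: t.
have ball_e s : `|s| = 1 -> ball 0 e (s * (e / 2)).
  move=> s1; rewrite /ball /= sub0r normrN normrM s1 mul1r gtr0_norm; lra.
have [E1 L1 P1] := He _ (ball_e 1 (normr1 _)).
have [E2 L2 P2] := He _ (ball_e (- 1) (normrN1 _)).
(* the linear terms at the two symmetric points cancel *)
have : 0 < (e / 2) ^+ 2 * g (1 * (e / 2)) + (e / 2) ^+ 2 * g (-1 * (e / 2)).
  by rewrite addr_gt0 ?mulr_gt0 ?exprn_gt0 ?divr_gt0.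
rewrite mul1r mulN1r sqrrN in E1 L1 P1 E2 L2 P2 *; lra.
Unshelve. all: by end_near. Qed.

Lemma jet2_cst {R : realType} (c : R) : jet2 (fun=> c) 0 0.
Proof.
exists (fun=> 0); split => //; first exact: cst_continuous.
by near=> t; rewrite mul0r mulr0 !addr0.
Unshelve. all: by end_near. Qed.

Lemma jet2D {R : realType} {f1 f2 : R -> R} {a1 b1 a2 b2 : R} :
  jet2 f1 a1 b1 -> jet2 f2 a2 b2 ->
  jet2 (fun t => f1 t + f2 t) (a1 + a2) (b1 + b2).
Proof.
move=> [g1 [c1 <- e1]] [g2 [c2 <- e2]]; exists (g1 \+ g2); split => //.
  exact: continuousD.
by near=> t => /=; rewrite (near e1 t) ?(near e2 t) //; ring.
Unshelve. all: by end_near. Qed.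

Lemma jet2M {R : realType} {f1 f2 : R -> R} {a1 b1 a2 b2 : R} :
  jet2 f1 a1 b1 -> jet2 f2 a2 b2 ->
  jet2 (fun t => f1 t * f2 t) (a1 * f2 0 + f1 0 * a2)
    (f1 0 * b2 + a1 * a2 + b1 * f2 0).
Proof.
move=> [g1 [c1 <- e1]] [g2 [c2 <- e2]].
exists (fun t => f1 0 * g2 t + a1 * a2 + g1 t * f2 0
  + t * (a1 * g2 t + a2 * g1 t) + t ^+ 2 * (g1 t * g2 t)); split.
- have ci : {for (0 : R), continuous id} by exact: cvg_id.
  have cc (u : R) : {for (0 : R), continuous (fun=> u)} by exact: cvg_cst.
  exact: (continuousD (continuousD (continuousD (continuousD
    (continuousM (cc _) c2) (cc _)) (continuousM c1 (cc _)))
    (continuousM ci (continuousD (continuousM (cc _) c2) (continuousM (cc _) c1))))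
    (continuousM (continuousM ci ci) (continuousM c1 c2))).
- by rewrite expr0n !mul0r !addr0.
by near=> t; rewrite (near e1 t) ?(near e2 t) //; ring.
Unshelve. all: by end_near. Qed.

(** The remainder factor is explicit here: subtracting the affine part from the
    inverse leaves a multiple of t^2. *)
Lemma jet2_inv_quadratic {R : realType} (A c : R) : A != 0 ->
  jet2 (fun t => (A + 2 * c * t + t ^+ 2)^-1)
    (- 2 * c * A ^- 2) ((4 * c ^+ 2 - A) * A ^- 3).
Proof.
move=> A0; pose q (t : R) := A + 2 * c * t + t ^+ 2.
have q00 : q 0 = A by rewrite /q expr0n mulr0 !addr0.
have ci : {for (0 : R), continuous id} by exact: cvg_id.
have cc (u : R) : {for (0 : R), continuous (fun=> u)} by exact: cvg_cst.
have cq : {for (0 : R), continuous q}.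
  exact: (continuousD (continuousD (cc A) (continuousM (cc (2 * c)) ci))
    (continuousM ci ci)).
have q0 : \forall t \near 0, q t != 0 by apply: (cvgr_neq0 _ cq); rewrite q00.
have cV : {for (0 : R), continuous (fun t => (q t)^-1)}.
  by apply: continuousV => //; rewrite q00.
exists (fun t => (4 * c ^+ 2 - A + 2 * c * t) * A ^- 2 * (q t)^-1); split.
- exact: (continuousM (continuousM (continuousD (cc _)
    (continuousM (cc (2 * c)) ci)) (cc _)) cV).
- by rewrite q00 mulr0 addr0; field.
near=> t; rewrite -/(q t) -/(q 0) q00.
have qt : q t != 0 by near: t.
by move: qt; rewrite /q => qt; field; rewrite A0 qt.
Unshelve. all: by end_near. Qed.

Lemma jet2_ext {R : realType} {f1 f2 : R -> R} {a b a' b' : R} :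
  f1 =1 f2 -> a = a' -> b = b' -> jet2 f1 a b -> jet2 f2 a' b'.
Proof. by move=> /funext -> -> ->. Qed.

(** When [A] is the squared distance from x to a point p and [c] is a coordinate
    of x - p, this expands |y - p|^(-2m) along a coordinate line through x. *)
Lemma jet2_inv_quadratic_exp {R : realType} (A c : R) (m : nat) : A != 0 ->
  jet2 (fun t => (A + 2 * c * t + t ^+ 2)^-1 ^+ m)
    (- (2 * m%:R * c * A^-1 ^+ m.+1))
    (m%:R * ((2 * m%:R + 2) * c ^+ 2 * A^-1 - 1) * A^-1 ^+ m.+1).
Proof.
move=> A0; elim: m => [|m IH].
  apply: (jet2_ext _ _ _ (jet2_cst 1)) => [t| |]; last 2 first.
  - by rewrite mulr0 !mul0r oppr0.
  - by rewrite !mul0r.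
  by rewrite expr0.
apply: (jet2_ext _ _ _ (jet2M (jet2_inv_quadratic A c A0) IH)).
- by move=> t; rewrite [RHS]exprS.
- rewrite expr0n mulr0 !addr0 -natr1 -!exprVn.
  set v := A^-1; rewrite !exprS expr0; ring.
- rewrite expr0n mulr0 !addr0 -natr1 -!exprVn.
  have : A * A^-1 = 1 by rewrite divff.
  move: (A^-1) => v Av.
  have -> : (4 * c ^+ 2 - A) * v ^+ 3 = (4 * c ^+ 2 * v - A * v) * v ^+ 2 by ring.
  rewrite Av !exprS expr0; ring.
Qed.

(** * Squared Euclidean distance *)

Definition dist2 {R : realType} {D : nat} (x y : 'rV[R]_D) : R :=
  \sum_(k < D) (x ord0 k - y ord0 k) ^+ 2.

Lemma dist2_ge0 {R : realType} {D : nat} (x y : 'rV[R]_D) : 0 <= dist2 x y.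
Proof. by apply: sumr_ge0 => k _; exact: sqr_ge0. Qed.

Lemma dist2xx {R : realType} {D : nat} (x : 'rV[R]_D) : dist2 x x = 0.
Proof. by rewrite /dist2 big1 // => k _; rewrite subrr expr0n. Qed.

Lemma dist2C {R : realType} {D : nat} (x y : 'rV[R]_D) : dist2 x y = dist2 y x.
Proof. by apply: eq_bigr => k _; rewrite -sqrrN opprB. Qed.

Lemma coord_le_dist2 {R : realType} {D : nat} (x y : 'rV[R]_D) k :
  (x ord0 k - y ord0 k) ^+ 2 <= dist2 x y.
Proof.
rewrite /dist2 (bigD1 k) //= lerDl; apply: sumr_ge0 => j _; exact: sqr_ge0.
Qed.

Lemma dist2_eq0 {R : realType} {D : nat} (x y : 'rV[R]_D) :
  (dist2 x y == 0) = (x == y).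
Proof.
apply/eqP/eqP => [d0|->]; last exact: dist2xx.
apply/rowP => k; apply/eqP; rewrite -subr_eq0 -sqrf_eq0.
by rewrite eq_le sqr_ge0 andbT -d0 coord_le_dist2.
Qed.

Lemma dist2_gt0 {R : realType} {D : nat} (x y : 'rV[R]_D) :
  (0 < dist2 x y) = (x != y).
Proof. by rewrite lt_neqAle dist2_ge0 andbT eq_sym dist2_eq0. Qed.

(** A triangle inequality that avoids square roots; the factor 2 is harmless since
    only the existence of small balls is at stake. *)
Lemma dist2_le_double {R : realType} {D : nat} (x y z : 'rV[R]_D) :
  dist2 x z <= 2 * (dist2 x y + dist2 y z).
Proof.
rewrite /dist2 -big_split mulr_sumr /=; apply: ler_sum => k _.
have := sqr_ge0 (x ord0 k - y ord0 k - (y ord0 k - z ord0 k)); nra.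
Qed.

Lemma dist2_coord_line {R : realType} {D : nat} (x c : 'rV[R]_D) k (t : R) :
  dist2 (x + t *: delta_mx ord0 k) c
  = dist2 x c + 2 * (x ord0 k - c ord0 k) * t + t ^+ 2.
Proof.
rewrite /dist2 (bigD1 k) //= [in RHS](bigD1 k) //= !mxE !eqxx mulr1.
rewrite [X in _ + X = _](eq_bigr (fun j => (x ord0 j - c ord0 j) ^+ 2)); last first.
  by move=> j jk; rewrite !mxE eqxx (negbTE jk) /= mulr0 addr0.
by ring.
Qed.

Lemma continuous_dist2 {R : realType} {D : nat} (c : 'rV[R]_D) :
  continuous (dist2^~ c).
Proof.
apply: continuous_big => [|k _ x]; first exact: add_continuous.
have ck : {for x, continuous (fun y : 'rV[R]_D => y ord0 k - c ord0 k)}.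
  by apply: continuousB; [exact: coord_continuous | exact: cst_continuous].
exact: (continuousM ck ck).
Qed.

Lemma continuous_line {R : realType} {D : nat} (x v : 'rV[R]_D) :
  continuous (fun t : R => x + t *: v).
Proof. 
move=> t; apply: cvgD; [exact: cvg_cst|apply: cvgZr_tmp; exact: cvg_id].
Qed.

(** Links the topology, given by the max norm, to Euclidean balls. *)
Lemma nbhs_dist2P {R : realType} {D : nat} (x : 'rV[R]_D) (P : set 'rV[R]_D) :
  nbhs x P <-> exists2 e, 0 < e & forall y, dist2 y x < e -> P y.
Proof.
split => [/nbhs_ballP[e /= e0 He]|[e e0 He]].
  exists (e ^+ 2); first by rewrite exprn_gt0.
  move=> y yx; apply: He; split=> // i j; rewrite ord1 /ball /= -ltr_sqr ?nnegrE ?(ltW e0) //.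
  rewrite real_normK ?num_real // -sqrrN opprB.
  exact: le_lt_trans (coord_le_dist2 _ _ _) yx.
have cx : dist2 y x @[y --> x] --> dist2 x x by exact: continuous_dist2.
have := cvgr_lt _ cx e; rewrite dist2xx => /(_ _ e0); apply: filterS => y; exact: He.
Qed.

(** * Laplacians and the second-order condition at a maximum *)

(** The factor 2 is there because [jet2] records half of each second
    derivative. *)
Definition has_laplacian {R : realType} {D : nat} (F : 'rV[R]_D -> R)
    (x : 'rV[R]_D) (L : R) : Prop :=
  exists a b : 'I_D -> R,
    (forall k, jet2 (fun t => F (x + t *: delta_mx ord0 k)) (a k) (b k))
    /\ L = 2 * \sum_k b k.

Lemma laplacian_le0 {R : realType} {D : nat} {F : 'rV[R]_D -> R} {x L} :
  has_laplacian F x L -> (\forall y \near x, F y <= F x) -> L <= 0.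
Proof.
move=> [a [b [Fjet ->]]] Fmax.
rewrite pmulr_rle0 //; apply: sumr_le0 => k _.
apply: (jet2_le0 (Fjet k)); rewrite scale0r addr0.
have xk : x + t *: delta_mx ord0 k @[t --> (0 : R)] --> x.
  have := continuous_line x (delta_mx ord0 k) (0 : R).
  by rewrite /continuous_at scale0r addr0.
exact: (xk _ Fmax).
Qed.

Lemma has_laplacianD {R : realType} {D : nat} {F G : 'rV[R]_D -> R} {x L M} :
  has_laplacian F x L -> has_laplacian G x M ->
  has_laplacian (fun y => F y + G y) x (L + M).
Proof.
move=> [a [b [Fjet ->]]] [c [d [Gjet ->]]].
exists (fun k => a k + c k), (fun k => b k + d k); split.
  by move=> k; exact: jet2D.
by rewrite big_split mulrDr.
Qed.

Lemma has_laplacianZ {R : realType} {D : nat} {F : 'rV[R]_D -> R} {x L} (c : R) :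
  has_laplacian F x L -> has_laplacian (fun y => c * F y) x (c * L).
Proof.
move=> [a [b [Fjet ->]]].
exists (fun k => c * a k), (fun k => c * b k); split.
  by move=> k; apply: (jet2_ext _ _ _ (jet2M (jet2_cst c) (Fjet k))) => //=; ring.
by rewrite -mulr_sumr; ring.
Qed.

Lemma has_laplacian_sum {R : realType} {D n : nat} {F : 'I_n -> 'rV[R]_D -> R}
    {x} {L : 'I_n -> R} :
  (forall i, has_laplacian (F i) x (L i)) ->
  has_laplacian (fun y => \sum_i F i y) x (\sum_i L i).
Proof.
elim: n F L => [|n IH] F L FL.
  exists (fun=> 0), (fun=> 0); split.
    move=> k; rewrite (_ : (fun t => _) = fun=> 0); first exact: jet2_cst.
    by apply/funext => t; rewrite big_ord0.
  by rewrite big_ord0 big1_eq mulr0.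
rewrite big_ord_recl.
under eq_fun do rewrite big_ord_recl.
by apply: has_laplacianD => //; apply: IH => i.
Qed.

(** Case m = 1 gives the sign of the Laplacian of J; case m = D, where the
    coefficient is positive, gives the barrier of the maximum principle. *)
Lemma has_laplacian_dist2_invX {R : realType} {D : nat} (c x : 'rV[R]_D) (m : nat) :
  x != c ->
  has_laplacian (fun y => (dist2 y c)^-1 ^+ m) x
    (2 * m%:R * (2 * m%:R + 2 - D%:R) * (dist2 x c)^-1 ^+ m.+1).
Proof.
move=> xc; have A0 : dist2 x c != 0 by rewrite dist2_eq0.
pose u k := x ord0 k - c ord0 k.
exists (fun k => - (2 * m%:R * u k * (dist2 x c)^-1 ^+ m.+1)).
exists (fun k => m%:R * ((2 * m%:R + 2) * u k ^+ 2 * (dist2 x c)^-1 - 1) *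
  (dist2 x c)^-1 ^+ m.+1); split.
  move=> k; apply: (jet2_ext _ _ _ (jet2_inv_quadratic_exp (dist2 x c) (u k) m A0)) => //.
  by move=> t; rewrite dist2_coord_line.
rewrite -mulr_suml -mulr_sumr sumrB -mulr_suml -mulr_sumr -/(dist2 x c).
rewrite sumr_const card_ord mulfK //; ring.
Qed.

(** * The strong maximum principle *)

Lemma compact_annulus {R : realType} {D : nat} (z : 'rV[R]_D) (d r : R) :
  compact [set x | d <= dist2 x z <= r].
Proof.
pose box := [set x : 'rV[R]_D |
  forall k, [set` `[z ord0 k - (r + 1), z ord0 k + (r + 1)]] (x ord0 k)].
have cbox : compact box.
  apply: (@rV_compact R D (fun k =>
    [set` `[z ord0 k - (r + 1), z ord0 k + (r + 1)]])) => k.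
  exact: segment_compact.
apply: (subclosed_compact _ cbox).
- rewrite (_ : [set x | _] = (dist2^~ z) @^-1` [set t | d <= t] `&`
      (dist2^~ z) @^-1` [set t | t <= r]).
    apply: closedI; apply: preimage_closed;
      [by move=> x _; exact: continuous_dist2|exact: closed_ge|
       by move=> x _; exact: continuous_dist2|exact: closed_le].
  by apply/seteqP; split => x /= => [/andP[]|[-> ->]].
- move=> x /= /andP[_ xr] k; have := le_trans (coord_le_dist2 x z k) xr.
  have r0 := le_trans (dist2_ge0 x z) xr.
  have := sqr_ge0 (x ord0 k - z ord0 k - 1).
  have := sqr_ge0 (x ord0 k - z ord0 k + 1).
  by rewrite /= in_itv /= => h1 h2 h; apply/andP; split; nra.
Qed.

(** The annulus is centred at [z], not at the maximum point [x]. The barrier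
    then decreases strictly from [x] to the outer sphere, which replaces
    the usual choice of a ball touching the set of maximum points. *)
Lemma strong_maximum_ball {R : realType} {D : nat} {F : 'rV[R]_D -> R}
    {z x : 'rV[R]_D} {r : R} :
  (1 <= D)%N ->
  (forall y, dist2 y z <= r -> {for y, continuous F}) ->
  (forall y, dist2 y z <= r -> exists2 L, has_laplacian F y L & 0 <= L) ->
  (forall y, dist2 y z <= r -> F y <= F x) ->
  dist2 x z < r -> F z = F x.
Proof.
move=> D1 Fcont Flap Fmax xr; have r0 := le_lt_trans (dist2_ge0 x z) xr.
apply/eqP; rewrite eq_le Fmax ?dist2xx ?(ltW r0) //= leNgt; apply/negP => Fzx.
have xz : 0 < dist2 x z.
  by rewrite dist2_gt0; apply: contraTneq Fzx => ->; rewrite ltxx.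
pose M := F x; pose eta := (M - F z) / 2.
have eta0 : 0 < eta by rewrite divr_gt0 // subr_gt0.
have [d0 d00 Hd0] : exists2 e, 0 < e & forall y, dist2 y z < e -> F y < M - eta.
  apply/nbhs_dist2P.
  have cz : F y @[y --> z] --> F z by apply: Fcont; rewrite dist2xx ltW.
  apply: (cvgr_lt _ cz); rewrite /eta; move: Fzx; rewrite -/M; lra.
(* inner radius: within the region of the margin, and closer to z than x is *)
pose d := Num.min (d0 / 2) (dist2 x z / 2).
have d_gt0 : 0 < d by rewrite lt_min !divr_gt0.
have dx : d < dist2 x z.
  by rewrite gt_min; apply/orP; right; rewrite ltr_pdivrMr // ltr_pMr // ltr1n.
have dd0 : d < d0.
  by rewrite gt_min; apply/orP; left; rewrite ltr_pdivrMr // ltr_pMr // ltr1n.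
(* on the inner sphere eps * h is exactly the margin eta *)
pose h y := (dist2 y z)^-1 ^+ D; pose eps := eta * d ^+ D.
have eps0 : 0 < eps by rewrite mulr_gt0 // exprn_gt0.
pose G y := F y + eps * h y.
have D0 : D != 0%N by rewrite -lt0n.
have [||p /[!inE]/= /andP[dp pr] Gp] := @compact_EVT_max _ R G _ _ (compact_annulus z d r).
- by exists x => /=; rewrite !ltW.
- apply: continuous_in_subspaceT => y /[!inE]/= /andP[dy yr].
  have ch : {for y, continuous h}.
    apply: (@continuous_comp _ _ _ (fun y => (dist2 y z)^-1) (fun t => t ^+ D)).
      apply: continuousV; first by rewrite gt_eqF // (lt_le_trans d_gt0).
      exact: continuous_dist2.
    exact: exprn_continuous.
  have ceps : {for y, continuous (fun=> eps)} by exact: cst_continuous.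
  exact: (continuousD (Fcont _ yr) (continuousM ceps ch)).
have Gxp : M + eps * h x <= G p by apply: Gp; rewrite inE /= !ltW.
have p0 := lt_le_trans d_gt0 dp.
have hx0 : 0 < eps * h x by rewrite mulr_gt0 // exprn_gt0 // invr_gt0.
(* not on the inner sphere, where F + eps * h < F x *)
have {dp}dp : d < dist2 p z.
  rewrite lt_neqAle dp andbT; apply/eqP => dpE.
  have : F p < M - eta by apply: Hd0; rewrite -dpE.
  have : eps * h p = eta by rewrite /eps /h -dpE exprVn mulfK // expf_neq0 // gt_eqF.
  move: Gxp; rewrite /G; lra.
(* not on the outer sphere, where h is smaller than at x *)
have {pr}pr : dist2 p z < r.
  rewrite lt_neqAle pr andbT; apply/eqP => prE.
  have : F p <= M by apply: Fmax; rewrite prE.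
  have : eps * h p < eps * h x.
    by rewrite ltr_pM2l // /h prE ltrXn2r // ?nnegrE ?invr_ge0 ?ltW // ltf_pV2.
  move: Gxp; rewrite /G; lra.
have [L FL L0] := Flap _ (ltW pr).
have pz : p != z by rewrite -dist2_gt0.
have := laplacian_le0 (has_laplacianD FL
  (has_laplacianZ eps (has_laplacian_dist2_invX z p D pz))).
have Gmax : \forall y \near p, F y + eps * (dist2 y z)^-1 ^+ D <=
    F p + eps * (dist2 p z)^-1 ^+ D.
  have cp : dist2 y z @[y --> p] --> dist2 p z by exact: continuous_dist2.
  have py := cvgr_gt _ cp _ dp; have yp := cvgr_lt _ cp _ pr.
  near=> y; apply: Gp; rewrite inE /=; apply/andP; split; apply: ltW.
    by near: y; exact: py.
  by near: y; exact: yp.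
move=> /(_ Gmax); apply/negP; rewrite -ltNge.
have DR : 0 < (D%:R : R) by rewrite ltr0n.
have c0 : 0 < 2 * D%:R * (2 * D%:R + 2 - D%:R) :> R by nra.
by rewrite ltr_wpDl // mulr_gt0 // mulr_gt0 // exprn_gt0 // invr_gt0.
Unshelve. all: by end_near. Qed.

(** * J is nowhere locally constant *)

Lemma poly_nonroot_itv {R : realType} {p : {poly R}} {a b : R} :
  p != 0 -> a < b -> exists2 t, a < t < b & p.[t] != 0.
Proof.
move=> p0 ab; apply: contrapT => noroot.
pose u (i : nat) : R := a + (b - a) / i.+2%:R.
have uab i : a < u i < b.
  apply/andP; split; first by rewrite ltrDl divr_gt0 ?subr_gt0.
  by rewrite /u -ltrBrDl ltr_pdivrMr // ltr_pMr ?subr_gt0 // ltr1n.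
have rs : all (root p) (mkseq u (size p)).
  apply/allP => t /mapP[i _ ->]; apply: contrapT => /negP ui.
  by apply: noroot; exists (u i).
have us : uniq (mkseq u (size p)).
  apply/mkseq_uniqP => i j _ _ /addrI /(mulfI (lt0r_neq0 _)) /invr_inj.
  by rewrite subr_gt0 => /(_ ab) /eqP; rewrite eqr_nat => /eqP[].
by have := max_poly_roots p0 rs us; rewrite size_mkseq ltnn.
Qed.

(** Polynomials in the parameter of a line turn an identity near 0 into an
    identity everywhere. *)
Definition line_dist2_poly {R : realType} {D : nat} (x y c : 'rV[R]_D) : {poly R} :=
  \sum_(k < D) ((x ord0 k - c ord0 k)%:P + (y ord0 k - x ord0 k) *: 'X) ^+ 2.

Lemma horner_line_dist2_poly {R : realType} {D : nat} (x y c : 'rV[R]_D) t :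
  (line_dist2_poly x y c).[t] = dist2 (x + t *: (y - x)) c.
Proof.
rewrite horner_sum; apply: eq_bigr => k _.
by rewrite !hornerE !mxE; ring.
Qed.

(** On the line from [x] to the source [S i0], clearing denominators in
    [J = c] yields a polynomial that vanishes near 0, hence identically. So at
    every point p of the line other than a source, J is [c], and in particular
    [w i0 <= c * |p - S i0|^2]. Such points accumulate at the source, where the
    right-hand side vanishes while [w i0] is positive. Sources that coincide
    or lie on the line need no separate treatment. *)
Lemma J_not_locally_constant {R : realType} {D n : nat} {S : 'I_n -> 'rV[R]_D}
    {w : 'I_n -> R} {x : 'rV[R]_D} (i0 : 'I_n) :
  (forall i, 0 < w i) -> (forall i, x != S i) ->
  ~ (\forall y \near x, J S w y = J S w x).
Proof.
move=> w0 xS Jx; pose c := J S w x; pose y := S i0.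
pose q i := line_dist2_poly x y (S i).
pose G := \prod_i q i.
(* numerator of J - c over the common denominator G *)
pose P := \sum_i w i *: \prod_(j | j != i) q j - c *: G.
have PE t : G.[t] != 0 -> P.[t] = (J S w (x + t *: (y - x)) - c) * G.[t].
  move=> Gt; rewrite !hornerE horner_sum mulrBl /J; congr (_ - _).
  rewrite mulr_suml; apply: eq_bigr => i _; rewrite hornerZ; move: Gt.
  rewrite /G (bigD1 i) //= hornerM mulf_eq0 negb_or => /andP[qi _].
  rewrite -/(dist2 _ _) -horner_line_dist2_poly mulrA; congr (_ * _).
  by rewrite divfK.
have G0 : G.[0] != 0.
  rewrite horner_prod; apply/prodf_neq0 => i _.
  by rewrite horner_line_dist2_poly scale0r addr0 dist2_eq0.
have Gneq0 : G != 0 by apply: contraNneq G0 => ->; rewrite horner0.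
have lx : x + t *: (y - x) @[t --> (0 : R)] --> x.
  have := continuous_line x (y - x) (0 : R).
  by rewrite /continuous_at scale0r addr0.
have P0 : P = 0.
  apply: contrapT => /eqP Pneq0.
  have [e /= e0 He] : nbhs_ball (0 : R) [set t | J S w (x + t *: (y - x)) = c].
    by apply/nbhs_ballP; exact: (lx _ Jx).
  have [t /andP[t0 te]] := poly_nonroot_itv (mulf_neq0 Pneq0 Gneq0) e0.
  rewrite hornerM mulf_eq0 negb_or => /andP[Pt Gt].
  move: Pt; rewrite PE // He ?subrr ?mul0r ?eqxx //.
  by rewrite /ball /= sub0r normrN gtr0_norm.
have Jc t : G.[t] != 0 -> J S w (x + t *: (y - x)) = c.
  move=> Gt; have := PE t Gt; rewrite P0 horner0 => /esym/eqP.
  by rewrite mulf_eq0 (negbTE Gt) orbF subr_eq0 => /eqP.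
(* negative at the source, but nonnegative at every non-root of G *)
pose H := c *: q i0 - (w i0)%:P.
have H1 : H.[1] < 0.
  rewrite !hornerE horner_line_dist2_poly scale1r subrKC dist2xx mulr0 sub0r.
  by rewrite oppr_lt0.
have [e /= e0 He] : nbhs_ball (1 : R) [set t | H.[t] < 0].
  have cH : H.[t] @[t --> (1 : R)] --> H.[1] by exact: continuous_horner.
  by apply/nbhs_ballP; exact: (cvgr_lt _ cH).
have [t /andP[t1 te] Gt] : exists2 t, 1 < t < 1 + e & G.[t] != 0.
  by apply: poly_nonroot_itv => //; rewrite ltrDl.
have : H.[t] < 0.
  apply: He; rewrite /ball /= distrC gtr0_norm ?subr_gt0 //; lra.
rewrite !hornerE horner_line_dist2_poly -(Jc t Gt) subr_lt0 ltNge => /negP; apply.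
have Sj j : 0 < dist2 (x + t *: (y - x)) (S j).
  rewrite lt_neqAle dist2_ge0 andbT eq_sym -horner_line_dist2_poly -/(q j).
  by move: Gt; rewrite horner_prod => /prodf_neq0; apply.
rewrite -ler_pdivrMr // /J (bigD1 i0) //= lerDl.
by apply: sumr_ge0 => j _; apply: divr_ge0; apply: ltW; last exact: Sj.
Qed.

(** * Interior extrema of J *)

Lemma continuous_J {R : realType} {D n : nat} (S : 'I_n -> 'rV[R]_D) w x :
  (forall i, x != S i) -> {for x, continuous (J S w)}.
Proof.
move=> xS; apply: (@cvg_big _ _ _ _ _ _ _ (nbhs x)) => [|i _].
  exact: add_continuous.
have cw : {for x, continuous (fun=> w i)} by exact: cst_continuous.
apply: (continuousM cw); apply: continuousV; last exact: continuous_dist2.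
by rewrite -/(dist2 _ _) dist2_eq0.
Qed.

Lemma has_laplacian_J {R : realType} {D n : nat} (S : 'I_n -> 'rV[R]_D) w x :
  (forall i, x != S i) ->
  has_laplacian (J S w) x
    (2 * (4 - D%:R) * \sum_i w i * (dist2 x (S i))^-1 ^+ 2).
Proof.
move=> xS; rewrite mulr_sumr.
have -> : J S w = fun y => \sum_i w i * (dist2 y (S i))^-1 ^+ 1.
  by apply/funext => y; apply: eq_bigr => i _; rewrite expr1.
apply: (has_laplacian_sum (F := fun i y => w i * (dist2 y (S i))^-1 ^+ 1)) => i.
have := has_laplacianZ (w i) (has_laplacian_dist2_invX (S i) x 1 (xS i)).
by rewrite (_ : w i * _ = 2 * (4 - D%:R) * (w i * (dist2 x (S i))^-1 ^+ 2)) //; ring.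
Qed.

(** The factor [s] = 1 or -1 turns both claims into one about maxima of the
    subharmonic function [s * J]. *)
Lemma no_interior_maximum {R : realType} {D n : nat} (S : 'I_n -> 'rV[R]_D)
    (w : 'I_n -> R) (Omega : set 'rV[R]_D) (s : R) (x : 'rV[R]_D) (i0 : 'I_n) :
  (1 <= D)%N -> (forall i, 0 < w i) -> open Omega ->
  (forall y, Omega y -> forall i, y != S i) ->
  s != 0 -> 0 <= s * (4 - D%:R) ->
  Omega x -> ~ (forall y, Omega y -> s * J S w y <= s * J S w x).
Proof.
move=> D1 w0 oO OS s0 sD Ox Jmax.
apply: (J_not_locally_constant i0 w0 (OS _ Ox)).
have [e e0 He] : exists2 e, 0 < e & forall y, dist2 y x < e -> Omega y.
  by apply/nbhs_dist2P; exact: open_nbhs_nbhs.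
(* radii: a ball of squared radius e/4 about z contains x and stays within
   squared distance 2 (e/4 + e/8) < e of x *)
apply/nbhs_dist2P; exists (e / 8) => [|z zx]; first by rewrite divr_gt0.
apply: (mulfI s0).
have inO y : dist2 y z <= e / 4 -> Omega y.
  move=> yz; apply: He; have := dist2_le_double y z x; lra.
apply: (strong_maximum_ball (F := fun y => s * J S w y) (r := e / 4) D1).
- move=> y /inO Oy.
  have cs : {for y, continuous (fun=> s)} by exact: cst_continuous.
  exact: (continuousM cs (continuous_J S w y (OS _ Oy))).
- move=> y /inO Oy; have JL := has_laplacianZ s (has_laplacian_J S w y (OS _ Oy)).
  eexists; first exact: JL.
  rewrite mulrA (mulrCA s); apply: mulr_ge0; first by apply: mulr_ge0.
  by apply: sumr_ge0 => i _; rewrite mulr_ge0 ?exprn_ge0 ?invr_ge0 ?dist2_ge0 ?ltW.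
- by move=> y /inO; exact: Jmax.
- rewrite dist2C; lra.
Qed.

Theorem theorem1 (R : realType) (D n : nat) (hD : (1 <= D)%N)
    (S : 'I_n -> 'rV[R]_D) (w : 'I_n -> R) (hw : forall i : 'I_n, 0 < w i)
    (Omega : set 'rV[R]_D) (hopen : open Omega)
    (hsrc : closure Omega `<=` ~` range S)
    (hJ : nonconstant_on (J S w) Omega) :
  ((D <= 4)%N ->
    forall X : 'rV[R]_D, max_on_at (J S w) (closure Omega) X -> boundary Omega X)
  /\
  ((4 <= D)%N ->
    forall X : 'rV[R]_D, min_on_at (J S w) (closure Omega) X -> boundary Omega X).
Proof.
have OS y : Omega y -> forall i, y != S i.
  move=> Oy i; apply/eqP => yS; apply: (hsrc y (subset_closure Oy)).
  by exists i.
(* J is an empty sum when there is no source *)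
have n0 : (0 < n)%N.
  rewrite lt0n; apply/eqP => n0; have [x [y [_ _]]] := hJ.
  by apply; subst n; rewrite /J !big_ord0.
have i0 := Ordinal n0.
split=> D4 X [cX Jext]; split=> // /interior_subset OX.
- apply: (no_interior_maximum S w Omega 1 X i0) => //.
    by rewrite mul1r subr_ge0 ler_nat.
  by move=> y Oy; rewrite !mul1r; apply: Jext; exact: subset_closure.
- apply: (no_interior_maximum S w Omega (-1) X i0) => //.
    by rewrite mulN1r opprB subr_ge0 ler_nat.
  by move=> y Oy; rewrite !mulN1r lerN2; apply: Jext; exact: subset_closure.
Qed.
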